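(* Let $(M,g)$ be a Riemannian manifold with Riemann curvature tensor $R$, let $p\in M$, and let $W,X,Y,Z\in T_pM$ and $\sigma\in\mathbb{R}$. If $(W,X,Y,Z,\sigma)$ solves the singular value problem of the Riemann tensor, then each of the following 5-tuples also solves it: $$(-W,X,Y,Z,-\sigma),\quad (W,-X,Y,Z,-\sigma),\quad (W,X,-Y,Z,-\sigma),\quad (W,X,Y,-Z,-\sigma).$$
   Context: Let $(M,g)$ be a Riemannian manifold, $\langle\cdot,\cdot\rangle = g(\cdot,\cdot)$, and $\nabla$ its Levi-Civita connection. The curvature operator is $R(X,Y) = [\nabla_X,\nabla_Y]-\nabla_{[X,Y]}$, and the $(0,4)$ curvature tensor is $R(W,Z,X,Y) := \langle W, R(X,Y)Z\rangle$ for $W,X,Y,Z\in T_pM$. Definition (singular value problem, SVP): a 5-tuple $(W,X,Y,Z,\sigma)$ with $W,X,Y,Z\in T_pM$ and $\sigma\in\mathbb{R}$ solves the singular value problem of the Riemann tensor if $$R(Y,Z)X=\sigma W,\quad R(Z,Y)W=\sigma X,\quad R(W,X)Z=\sigma Y,\quad R(X,W)Y=\sigma Z,$$ and $$\langle W,W\rangle=\langle X,X\rangle=\langle Y,Y\rangle=\langle Z,Z\rangle=1.$$ *)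

(* Defs.v *)
From HB Require Import structures.
From mathcomp Require Import all_boot all_order all_algebra.
From mathcomp Require Import all_classical all_reals all_analysis.
From mathcomp Require Import ring.
Set Implicit Arguments.
Unset Strict Implicit.
Unset Printing Implicit Defensive.
Import Order.TTheory GRing.Theory Num.Theory.
Import numFieldNormedType.Exports.
Local Open Scope classical_set_scope.
Local Open Scope ring_scope.

(* Only the values of [f] on the open set [U] matter; see [Ck_ext]. *)
Fixpoint Ck (R : realType) (n k : nat) (U : set 'rV[R]_n)
    (f : 'rV[R]_n -> R) : Prop :=
  (forall x, U x -> {for x, continuous f}) /\
  match k with
  | 0 => True
  | k'.+1 => forall i : 'I_n,
      (forall x, U x -> derivable f x (delta_mx 0 i)) /\
      Ck k' U (fun x => 'D_(delta_mx 0 i) f x)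
  end.

Definition smooth_on (R : realType) (n : nat) (U : set 'rV[R]_n)
  (f : 'rV[R]_n -> R) : Prop := forall k, Ck k U f.

Section Ck_theory.
Context {R : realType} {n : nat} (U : set 'rV[R]_n).
Hypothesis oU : open U.
Implicit Types f g : 'rV[R]_n -> R.

Let nearU x (P : 'rV[R]_n -> Prop) :
  U x -> (forall y, U y -> P y) -> \near x, P x.
Proof.
move=> Ux UP; have : nbhs x U by exact: open_nbhs_nbhs.
by apply: filterS => y /UP.
Qed.

Lemma Ck_ext k f g : (forall x, U x -> f x = g x) -> Ck k U f -> Ck k U g.
Proof.
elim: k f g => [|k IHk] f g fg /= [cf Df].
all: have nfg x : U x -> \near x, f x = g x by move=> Ux; exact: nearU.
all: have cg x : U x -> {for x, continuous g}.
1,3: move=> Ux; rewrite /prop_for /continuous_at -(fg _ Ux).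
1,2: by apply: cvg_trans (cf x Ux); exact: near_eq_cvg (nfg _ Ux).
all: split=> // i; have [dfi Di] := Df i; split.
  by move=> x Ux; have := dfi x Ux; apply: near_eq_derivable; first exact: nfg.
by apply: IHk Di => x Ux; apply: near_eq_derive; exact: nfg.
Qed.

Lemma CkW k f : Ck k.+1 U f -> Ck k U f.
Proof.
elim: k f => [|k IHk] f; first by case.
move=> [cf Df]; split=> // i; have [? Di] := Df i; split=> //.
exact: IHk.
Qed.

Lemma Ck_cst k (a : R) : Ck k U (cst a).
Proof.
elim: k a => [|k IHk] a; (split; first by move=> x _; exact: cst_continuous).
  by [].
move=> i; split=> [x _|]; first exact: derivable_cst.
by apply: Ck_ext (IHk 0) => x _; rewrite derive_cst.
Qed.

Lemma CkD k f g : Ck k U f -> Ck k U g -> Ck k U (f + g).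
Proof.
elim: k f g => [|k IHk] f g [cf Df] [cg Dg].
all: split; first by move=> x Ux; apply: continuousD; [exact: cf|exact: cg].
  by [].
move=> i; have [dfi Dfi] := Df i; have [dgi Dgi] := Dg i.
split=> [x Ux|].
  by apply: derivableD; [exact: dfi|exact: dgi].
apply: Ck_ext (IHk _ _ Dfi Dgi) => x Ux.
by rewrite deriveD; [|exact: dfi|exact: dgi].
Qed.

Lemma CkM k f g : Ck k U f -> Ck k U g -> Ck k U (f * g).
Proof.
elim: k f g => [|k IHk] f g kf kg; have [cf Df] := kf; have [cg Dg] := kg.
all: split; first by move=> x Ux; apply: continuousM; [exact: cf|exact: cg].
  by [].
move=> i; have [dfi Dfi] := Df i; have [dgi Dgi] := Dg i.
split=> [x Ux|].
  by apply: derivableM; [exact: dfi|exact: dgi].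
apply: Ck_ext (CkD (IHk _ _ (CkW kf) Dgi) (IHk _ _ (CkW kg) Dfi)) => x Ux.
by rewrite deriveM; [|exact: dfi|exact: dgi].
Qed.

End Ck_theory.

Record chart (R : realType) (n : nat) (M : topologicalType) := Chart {
  chart_dom : set M;
  chart_fun :> M -> 'rV[R]_n;
  chart_inv : 'rV[R]_n -> M;
  chart_dom_open : open chart_dom;
  chart_codom_open : open (chart_fun @` chart_dom);
  chart_funK : forall x, chart_dom x -> chart_inv (chart_fun x) = x;
  chart_fun_continuous : {within chart_dom, continuous chart_fun};
  chart_inv_continuous :
    {within chart_fun @` chart_dom, continuous chart_inv} }.

(* The atlas need not be maximal: any smooth atlas determines the smooth
   structure. *)
Record smoothManifold (R : realType) (n : nat) := SmoothManifold {
  manifold_sort :> topologicalType;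
  atlas : set (chart R n manifold_sort);
  manifold_hausdorff : hausdorff_space manifold_sort;
  manifold_second_countable : @second_countable manifold_sort;
  atlas_cover : forall x : manifold_sort,
    exists2 c, atlas c & chart_dom c x;
  atlas_compatible : forall c d, atlas c -> atlas d ->
    forall i : 'I_n, smooth_on (c @` (chart_dom c `&` chart_dom d))
                               (fun u => d (chart_inv c u) 0 i) }.

Section smooth_functions.
Context {R : realType} {n : nat} (M : smoothManifold R n).

Definition smooth (f : M -> R) : Prop :=
  forall c, atlas c ->
    smooth_on (c @` chart_dom c) (fun u => f (chart_inv c u)).

Definition smooth_pred : {pred M -> R} := mem [set f | smooth f].

Lemma smooth_cst (a : R) : smooth (cst a).
Proof. by move=> c _ k; apply: Ck_cst; exact: chart_codom_open. Qed.

Lemma smoothD f g : smooth f -> smooth g -> smooth (f + g).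
Proof.
by move=> sf sg c Mc k; apply: CkD;
  [exact: chart_codom_open|exact: sf|exact: sg].
Qed.

Lemma smoothM f g : smooth f -> smooth g -> smooth (f * g).
Proof.
by move=> sf sg c Mc k; apply: CkM;
  [exact: chart_codom_open|exact: sf|exact: sg].
Qed.

Lemma smoothZ a f : smooth f -> smooth (a *: f).
Proof. exact: smoothM (smooth_cst a). Qed.

Lemma smooth_subring_closed : subring_closed smooth_pred.
Proof.
split=> [|f g /[!inE]|f g /[!inE]]; first by rewrite inE; exact: smooth_cst.
- move=> sf sg; apply: smoothD => //; rewrite -scaleN1r; exact: smoothZ.
- exact: smoothM.
Qed.

HB.instance Definition _ :=
  GRing.isSubringClosed.Build (M -> R) smooth_pred smooth_subring_closed.

Lemma smooth_scaler_closed : scaler_closed smooth_pred.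
Proof. by move=> a f /[!inE]; exact: smoothZ. Qed.

HB.instance Definition _ :=
  GRing.isScaleClosed.Build R (M -> R) smooth_pred smooth_scaler_closed.

Record smooth_fun := SmoothFun {
  smooth_fun_val :> M -> R;
  smooth_funP : smooth_fun_val \in smooth_pred }.

HB.instance Definition _ := [isSub for smooth_fun_val].
HB.instance Definition _ := [Choice of smooth_fun by <:].
HB.instance Definition _ := GRing.SubChoice_isSubComPzRing.Build
  (M -> R) smooth_pred smooth_fun (subringClosedP _).
HB.instance Definition _ := [SubZmodule_isSubLmodule of smooth_fun by <:].

Lemma smooth_fun_eq (f g : smooth_fun) : (forall p, f p = g p) -> f = g.
Proof. by move=> fg; apply/val_inj/funext. Qed.

Definition mk_smooth (f : M -> R) (sf : smooth f) : smooth_fun :=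
  @SmoothFun f (mem_set sf).

Lemma smooth_funW (f : smooth_fun) : smooth f.
Proof. exact: set_mem (smooth_funP f). Qed.

(* [tangent p] is T_p M as the space of derivations at [p] of the ring of
   globally defined smooth functions. *)
Definition derivation_at (p : M) : {pred smooth_fun -> R} :=
  mem [set v : smooth_fun -> R |
    (forall (a : R) (f g : smooth_fun), v (a *: f + g) = a * v f + v g) /\
    (forall f g : smooth_fun, v (f * g) = f p * v g + v f * g p)].

Lemma derivation_at_submod_closed p : submod_closed (derivation_at p).
Proof.
split; first by rewrite inE; split=> *; rewrite /= !(mulr0, mul0r, addr0).
move=> b v w /[!inE] -[vD vM] [wD wM].
have E f : (b *: v + w) f = b * v f + w f by [].
by split=> [a f g|f g] /=; rewrite !E ?vD ?wD ?vM ?wM; ring.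
Qed.

HB.instance Definition _ p := GRing.isSubmodClosed.Build R (smooth_fun -> R)
  (derivation_at p) (derivation_at_submod_closed p).

Record tangent (p : M) := Tangent {
  tangent_val :> smooth_fun -> R;
  tangentP : tangent_val \in derivation_at p }.

HB.instance Definition _ p := [isSub for @tangent_val p].
HB.instance Definition _ p := [Choice of tangent p by <:].
HB.instance Definition _ p := [SubChoice_isSubLmodule of tangent p by <:].

Lemma tangent_eq p (v w : tangent p) : (forall f, v f = w f) -> v = w.
Proof. by move=> vw; apply/val_inj/funext. Qed.

Record vector_field := VectorField {
  vf_val :> forall p : M, tangent p;
  vf_smooth : forall f : smooth_fun, smooth (fun p => vf_val p f) }.

Lemma vf_eq (X Y : vector_field) : (forall p, X p = Y p) -> X = Y.
Proof.
case: X Y => [X sX] [Y sY] /= XY.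
have {}XY : X = Y by exact: functional_extensionality_dep.
by rewrite {}XY in sX *; congr VectorField; exact: Prop_irrelevance.
Qed.

Definition vf_app (X : vector_field) (f : smooth_fun) : smooth_fun :=
  mk_smooth (vf_smooth X f).

Lemma vf_appP (X : vector_field) f p : vf_app X f p = X p f.
Proof. by []. Qed.

Lemma tangentD p (v : tangent p) f g : v (f + g) = v f + v g.
Proof.
by case: (set_mem (tangentP v)) => vD _; have := vD 1 f g; rewrite scale1r mul1r.
Qed.

Lemma tangentZ p (v : tangent p) a f : v (a *: f) = a * v f.
Proof.
case: (set_mem (tangentP v)) => vD _; have := vD a f 0.
have -> : v 0 = 0.
  by apply: (addrI (v 0)); rewrite -tangentD !addr0.
by rewrite !addr0.
Qed.

Lemma tangentM p (v : tangent p) f g : v (f * g) = f p * v g + v f * g p.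
Proof. by case: (set_mem (tangentP v)) => _; exact. Qed.

Lemma smoothB f g : smooth f -> smooth g -> smooth (f - g).
Proof.
by move=> sf sg; apply: smoothD => //; rewrite -scaleN1r; exact: smoothZ.
Qed.

End smooth_functions.

Section vector_field_module.
Context {R : realType} {n : nat} {M : smoothManifold R n}.
Implicit Types (X Y Z : vector_field M) (f g : smooth_fun M).

HB.instance Definition _ := gen_eqMixin (vector_field M).
HB.instance Definition _ := gen_choiceMixin (vector_field M).

Definition vf_zero : vector_field M :=
  @VectorField _ _ M (fun p => 0) (fun f => smooth_cst 0).

Definition vf_opp X : vector_field M :=
  @VectorField _ _ M (fun p => - X p) (fun f => smooth_funW (- vf_app X f)).

Definition vf_add X Y : vector_field M :=
  @VectorField _ _ M (fun p => X p + Y p)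
    (fun f => smooth_funW (vf_app X f + vf_app Y f)).

Definition vf_scale g X : vector_field M :=
  @VectorField _ _ M (fun p => g p *: X p)
    (fun f => smooth_funW (g * vf_app X f)).

Fact vf_addA : associative vf_add.
Proof. by move=> X Y Z; apply: vf_eq => p; exact: addrA. Qed.
Fact vf_addC : commutative vf_add.
Proof. by move=> X Y; apply: vf_eq => p; exact: addrC. Qed.
Fact vf_add0 : left_id vf_zero vf_add.
Proof. by move=> X; apply: vf_eq => p; exact: add0r. Qed.
Fact vf_addN : left_inverse vf_zero vf_opp vf_add.
Proof. by move=> X; apply: vf_eq => p; exact: addNr. Qed.

HB.instance Definition _ := GRing.isZmodule.Build (vector_field M)
  vf_addA vf_addC vf_add0 vf_addN.

Fact vf_scaleA f g X : vf_scale f (vf_scale g X) = vf_scale (f * g) X.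
Proof. by apply: vf_eq => p; exact: scalerA. Qed.
Fact vf_scale1 : left_id 1 vf_scale.
Proof. by move=> X; apply: vf_eq => p; exact: scale1r. Qed.
Fact vf_scaleDr : right_distributive vf_scale +%R.
Proof. by move=> f X Y; apply: vf_eq => p; exact: scalerDr. Qed.
Fact vf_scaleDl X : {morph vf_scale^~ X : f g / f + g}.
Proof. by move=> f g; apply: vf_eq => p; exact: scalerDl. Qed.

HB.instance Definition _ := GRing.Zmodule_isLmodule.Build (smooth_fun M)
  (vector_field M) vf_scaleA vf_scale1 vf_scaleDr vf_scaleDl.

Definition lie_fun X Y (p : M) (f : smooth_fun M) : R :=
  X p (vf_app Y f) - Y p (vf_app X f).

Fact lie_funP X Y p : lie_fun X Y p \in derivation_at p.
Proof.
have appD Z a f g : vf_app Z (a *: f + g) = a *: vf_app Z f + vf_app Z g.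
  by apply: smooth_fun_eq => q; rewrite vf_appP tangentD tangentZ.
have appM Z f g : vf_app Z (f * g) = f * vf_app Z g + vf_app Z f * g.
  by apply: smooth_fun_eq => q; rewrite vf_appP tangentM.
rewrite inE; split=> [a f g|f g]; rewrite /lie_fun.
  by rewrite !appD !tangentD !tangentZ; ring.
by rewrite !appM !tangentD !tangentM !vf_appP; ring.
Qed.

Definition lie_bracket X Y : vector_field M :=
  @VectorField _ _ M (fun p => Tangent (lie_funP X Y p))
    (fun f => smooth_funW (vf_app X (vf_app Y f) - vf_app Y (vf_app X f))).

End vector_field_module.

Record riemannian_metric (R : realType) (n : nat) (M : smoothManifold R n) :=
  RiemannianMetric {
    metric_val :> forall p : M, tangent p -> tangent p -> R;
    metric_linearl : forall p (a : R) (u v w : tangent p),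
      metric_val (a *: u + v) w = a * metric_val u w + metric_val v w;
    metricC : forall p (u v : tangent p), metric_val u v = metric_val v u;
    metric_gt0 : forall p (v : tangent p), v != 0 -> 0 < metric_val v v;
    metric_smooth : forall X Y : vector_field M,
      smooth (fun p : M => metric_val (X p) (Y p)) }.

Section curvature.
Context {R : realType} {n : nat} {M : smoothManifold R n}.

Definition metric_app (g : riemannian_metric M) (X Y : vector_field M) :
  smooth_fun M := mk_smooth (metric_smooth g X Y).

(* Additivity and the Leibniz rule in the second argument give linearity over
   the reals, the latter applied to constant functions. *)
Record affine_connection := AffineConnection {
  nabla :> vector_field M -> vector_field M -> vector_field M;
  nabla_linear : forall (f : smooth_fun M) (X Y Z : vector_field M),
    nabla (f *: X + Y) Z = f *: nabla X Z + nabla Y Z;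
  nabla_additive : forall X Y Z : vector_field M,
    nabla X (Y + Z) = nabla X Y + nabla X Z;
  nabla_leibniz : forall (X : vector_field M) (f : smooth_fun M) Y,
    nabla X (f *: Y) = vf_app X f *: Y + f *: nabla X Y }.

Definition torsion_free (D : affine_connection) : Prop :=
  forall X Y : vector_field M, D X Y - D Y X = lie_bracket X Y.

Definition metric_compatible (g : riemannian_metric M)
    (D : affine_connection) : Prop :=
  forall X Y Z : vector_field M,
    vf_app X (metric_app g Y Z) =
    metric_app g (D X Y) Z + metric_app g Y (D X Z).

Definition levi_civita (g : riemannian_metric M) (D : affine_connection) :
  Prop := torsion_free D /\ metric_compatible g D.

Definition curvature (D : affine_connection) (X Y Z : vector_field M) :
  vector_field M := D X (D Y Z) - D Y (D X Z) - D (lie_bracket X Y) Z.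

(* [riemann D x y z] is [R(x, y) z]: the common value at [p] of [R(X, Y) Z] over
   all global vector fields [X], [Y], [Z] with values [x], [y], [z] at [p].
   Such extensions exist because [M] is Hausdorff, and the value does not depend
   on them because [R] is tensorial, so the default [0] is never taken. *)
Definition riemann (D : affine_connection) (p : M) (x y z : tangent p) :
  tangent p :=
  xget 0 [set v |
    (exists X Y Z : vector_field M, [/\ X p = x, Y p = y & Z p = z]) /\
    (forall X Y Z : vector_field M, X p = x -> Y p = y -> Z p = z ->
       curvature D X Y Z p = v)].

(* The arguments are ordered as in the tuple (W, X, Y, Z, sigma). *)
Definition solves_SVP (g : riemannian_metric M) (D : affine_connection)
    (p : M) (W X Y Z : tangent p) (sigma : R) : Prop :=
  [/\ riemann D Y Z X = sigma *: W,
      riemann D Z Y W = sigma *: X,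
      riemann D W X Z = sigma *: Y,
      riemann D X W Y = sigma *: Z &
      [/\ g p W W = 1, g p X X = 1, g p Y Y = 1 & g p Z Z = 1]].

End curvature.

Arguments affine_connection {R n} M.

(* Main.v *)
Require Import Defs.
From mathcomp Require Import all_boot all_order all_algebra.
From mathcomp Require Import all_classical all_reals all_analysis.
Import Order.TTheory GRing.Theory Num.Theory.
Local Open Scope ring_scope.

(** The pointwise curvature [riemann D x y z] is odd in each of [x], [y], [z].
    In each of the four curvature equations of the singular value problem, every
    one of the vectors W, X, Y, Z occurs exactly once, either as an argument of
    the curvature or on the right-hand side. Negating one of the vectors
    therefore flips the sign of exactly one of these occurrences in each
    equation, and negating sigma compensates for it. The norms do not change.

    Oddness is first proved for vector fields, where it follows from additivity
    of the connection and oddness of the Lie bracket ([curvatureN1],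
    [curvatureN2], [curvatureN3]). It passes to tangent vectors because negation is a bijection
    between the vector fields extending [x] and those extending [- x]: the values
    that qualify for [riemann D (- x) y z] are the opposites of those that
    qualify for [riemann D x y z]. At most one value qualifies, so if one does,
    the two choices are opposite; if none does, both are the default [0], which
    is its own opposite. *)

Lemma additive_odd (U V : zmodType) (h : U -> V) :
  {morph h : x y / x + y} -> {morph h : x / - x}.
Proof.
move=> hD x; apply/eqP; rewrite -addr_eq0 -hD addNr.
(* The goal [h 0 = 0] is cancelled from [h 0 + h 0 = h 0]. *)
by apply/eqP/(addrI (h 0)); rewrite -hD !addr0.
Qed.

(** Subsingletons [A] are needed here: on larger sets the choice made by [xget]
    need not commute with negation. *)
Lemma xgetN (V : zmodType) (A B : set V) :
  is_subset1 A -> (forall v, B v <-> A (- v)) -> xget 0 B = - xget 0 A.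
Proof.
move=> A1 BA; case: (xgetP 0 A) => [v _ Av | A0]; last first.
  by rewrite oppr0; apply: xgetPN => v /BA; exact: A0.
apply: xget_unique => [|w /BA Aw]; first by apply/BA; rewrite opprK.
by apply: oppr_inj; rewrite opprK; exact: A1.
Qed.

Section odd_curvature.
Context {R : realType} {n : nat} {M : smoothManifold R n}.
Implicit Types (D : affine_connection M) (X Y Z : vector_field M).

Lemma tangentN p (v : tangent p) (f : smooth_fun M) : v (- f) = - v f.
Proof. exact: (additive_odd _ _ v (tangentD v)). Qed.

Lemma lie_bracketNl X Y : lie_bracket (- X) Y = - lie_bracket X Y.
Proof.
apply: vf_eq => p; apply: tangent_eq => f.
change (- X p (vf_app Y f) - Y p (vf_app (- X) f) =
        - (X p (vf_app Y f) - Y p (vf_app X f))).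
have -> : vf_app (- X) f = - vf_app X f by exact: smooth_fun_eq.
by rewrite tangentN opprB opprK addrC.
Qed.

Lemma lie_bracketC X Y : lie_bracket X Y = - lie_bracket Y X.
Proof.
apply: vf_eq => p; apply: tangent_eq => f.
by rewrite -[RHS]/(- (Y p (vf_app X f) - X p (vf_app Y f))) opprB.
Qed.

Lemma nablaNl D X Z : D (- X) Z = - D X Z.
Proof.
apply: (additive_odd _ _ (D ^~ Z)) => {}X Y.
by have := nabla_linear D 1 X Y Z; rewrite !scale1r.
Qed.

Lemma nablaNr D X Z : D X (- Z) = - D X Z.
Proof. exact: (additive_odd _ _ (D X) (nabla_additive D X)). Qed.

Lemma curvatureC D X Y Z : curvature D X Y Z = - curvature D Y X Z.
Proof.
by rewrite /curvature (lie_bracketC X) nablaNl opprD opprB opprK.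
Qed.

Lemma curvatureN1 D X Y Z : curvature D (- X) Y Z = - curvature D X Y Z.
Proof. by rewrite /curvature lie_bracketNl !nablaNl nablaNr !opprD. Qed.

Lemma curvatureN2 D X Y Z : curvature D X (- Y) Z = - curvature D X Y Z.
Proof. by rewrite curvatureC curvatureN1 -curvatureC. Qed.

Lemma curvatureN3 D X Y Z : curvature D X Y (- Z) = - curvature D X Y Z.
Proof. by rewrite /curvature !nablaNr !opprD. Qed.

(** The set in the definition of [riemann D x y z], named so that its change
    under negation can be stated. *)
Definition curvature_values D {p : M} (x y z : tangent p) : set (tangent p) :=
  [set v |
    (exists X Y Z : vector_field M, [/\ X p = x, Y p = y & Z p = z]) /\
    (forall X Y Z : vector_field M, X p = x -> Y p = y -> Z p = z ->
       curvature D X Y Z p = v)]%classic.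

Lemma curvature_values_subset1 D {p : M} (x y z : tangent p) :
  is_subset1 (curvature_values D x y z).
Proof.
by move=> v w [[X [Y [Z [Xx Yy Zz]]]] Dv] [_ Dw]; rewrite -(Dv X Y Z) ?(Dw X Y Z).
Qed.

Lemma curvature_valuesN1 D {p : M} (x y z v : tangent p) :
  curvature_values D x y z v -> curvature_values D (- x) y z (- v).
Proof.
move=> [[X [Y [Z [Xx Yy Zz]]]] Dv]; split.
  by exists (- X), Y, Z; split=> //; rewrite -Xx.
move=> {Xx Yy Zz}X {}Y {}Z Xx Yy Zz; rewrite -(Dv (- X) Y Z) //; last first.
  by rewrite -[LHS]/(- X p) Xx opprK.
by rewrite -[RHS]/((- curvature D (- X) Y Z) p) -curvatureN1 opprK.
Qed.

Lemma curvature_valuesN2 D {p : M} (x y z v : tangent p) :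
  curvature_values D x y z v -> curvature_values D x (- y) z (- v).
Proof.
move=> [[X [Y [Z [Xx Yy Zz]]]] Dv]; split.
  by exists X, (- Y), Z; split=> //; rewrite -Yy.
move=> {Xx Yy Zz}X {}Y {}Z Xx Yy Zz; rewrite -(Dv X (- Y) Z) //; last first.
  by rewrite -[LHS]/(- Y p) Yy opprK.
by rewrite -[RHS]/((- curvature D X (- Y) Z) p) -curvatureN2 opprK.
Qed.

Lemma curvature_valuesN3 D {p : M} (x y z v : tangent p) :
  curvature_values D x y z v -> curvature_values D x y (- z) (- v).
Proof.
move=> [[X [Y [Z [Xx Yy Zz]]]] Dv]; split.
  by exists X, Y, (- Z); split=> //; rewrite -Zz.
move=> {Xx Yy Zz}X {}Y {}Z Xx Yy Zz; rewrite -(Dv X Y (- Z)) //; last first.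
  by rewrite -[LHS]/(- Z p) Zz opprK.
by rewrite -[RHS]/((- curvature D X Y (- Z)) p) -curvatureN3 opprK.
Qed.

Lemma riemannN1 D {p : M} (x y z : tangent p) :
  riemann D (- x) y z = - riemann D x y z.
Proof.
apply: xgetN; first exact: curvature_values_subset1.
by move=> v; split=> /curvature_valuesN1; rewrite opprK.
Qed.

Lemma riemannN2 D {p : M} (x y z : tangent p) :
  riemann D x (- y) z = - riemann D x y z.
Proof.
apply: xgetN; first exact: curvature_values_subset1.
by move=> v; split=> /curvature_valuesN2; rewrite opprK.
Qed.

Lemma riemannN3 D {p : M} (x y z : tangent p) :
  riemann D x y (- z) = - riemann D x y z.
Proof.
apply: xgetN; first exact: curvature_values_subset1.
by move=> v; split=> /curvature_valuesN3; rewrite opprK.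
Qed.

Lemma metricNN (g : riemannian_metric M) {p : M} (v : tangent p) :
  g p (- v) (- v) = g p v v.
Proof.
have gNl u w : g p (- u) w = - g p u w.
  apply: (additive_odd _ _ (g p ^~ w)) => {}u v'.
  by have := metric_linearl g 1 u v' w; rewrite scale1r mul1r.
by rewrite gNl metricC gNl opprK.
Qed.

End odd_curvature.

Theorem proposition2 (R : realType) (n : nat) (M : smoothManifold R n)
    (g : riemannian_metric M) (D : affine_connection M)
    (D_levi_civita : levi_civita g D)
    (p : M) (W X Y Z : tangent p) (sigma : R) :
  solves_SVP g D W X Y Z sigma ->
  [/\ solves_SVP g D (- W) X Y Z (- sigma),
      solves_SVP g D W (- X) Y Z (- sigma),
      solves_SVP g D W X (- Y) Z (- sigma) &
      solves_SVP g D W X Y (- Z) (- sigma)].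
Proof.
move=> [eW eX eY eZ [nW nX nY nZ]].
by split; split; rewrite ?metricNN ?riemannN1 ?riemannN2 ?riemannN3
  ?eW ?eX ?eY ?eZ ?scalerN ?scaleNr ?opprK.
Qed.
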